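(* Let $K$ be a field, let $P$ be a finite poset, and let $(\Pi,p)$, with $\Pi=(F_x)_{x\in P}$ a system of subsets of a finite set $F$, be a presentation of a sectioned $KP$-algebra $T$. Then: (i) $\operatorname{Ker}(\pi)=\bigcap_{x\in P}\operatorname{Ker}(\pi_x)=I_{\Delta_\Pi}$ is the Stanley--Reisner ideal of $\Delta_\Pi$ in $K[F]$. (ii) $\operatorname{Ker}(p_P\circ\pi)=\sum_{x\in P}(\iota_x(\operatorname{Ker}(p_x)))+\bigcap_{x\in P}\operatorname{Ker}(\pi_x)$, where $(\iota_x(\operatorname{Ker}(p_x)))$ is the ideal of $K[F]$ generated by $\iota_x(\operatorname{Ker}(p_x))$. In particular, $$\lim_P T\cong K[F]\Big/\Big(\sum_{x\in P}I_x+I_{\Delta_\Pi}\Big),$$ where $I_x$ is the ideal of $K[F]$ generated by $\operatorname{Ker}(p_x\circ\pi_x)\cap\iota_x(K[F_x])$ for $x\in P$.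
   Context: A $KP$-algebra $T$ is a system of commutative $K$-algebras $(T_x)_{x\in P}$ with $K$-algebra homomorphisms $T_{xy}\colon T_y\to T_x$ for $x\le y$, $T_{xx}=\mathrm{id}$, $T_{xy}T_{yz}=T_{xz}$. Its limit is $\lim_P T=\{(s_x)\in\prod_xT_x:T_{xy}(s_y)=s_x\ \forall x\le y\}$, with projections $\pi(T)_x\colon\lim_PT\to T_x$. A sectioned $KP$-algebra $(T,\iota(T))$ is a $KP$-algebra $T$ with $K$-linear maps $\iota(T)_x\colon T_x\to\lim_PT$ such that $\pi(T)_x\circ\iota(T)_x=\mathrm{id}_{T_x}$ for all $x\in P$. Let $\Pi=(F_x)_{x\in P}$ be a system of subsets of a finite set $F$ with $F_x\cap F_y=\bigcup_{z\le x,\,z\le y}F_z$ for all $x,y\in P$. $K[F]$ is the polynomial ring on the elements of $F$; $\iota_x\colon K[F_x]\to K[F]$ is the inclusion and $\pi_x\colon K[F]\to K[F_x]$ the projection with $\pi_x(a)=a$ for $a\in F_x$, $\pi_x(a)=0$ for $a\in F\setminus F_x$. The $KP$-algebra $T^\Pi$ has $(T^\Pi)_x=K[F_x]$ and $(T^\Pi)_{xy}(f)=\pi_x(f)$ for $x\le y$, $f\in K[F_y]\subseteq K[F]$. The projections $\pi_x$ induce a homomorphism $\pi\colon K[F]\to\lim_PT^\Pi$, which in the setting considered is surjective. $T^\Pi$ is sectioned by $\iota(T^\Pi)_x(f)=(\pi_y(\iota_x(f)))_{y\in P}$. $\Delta_\Pi$ is the simplicial complex of subsets $G\subseteq F$ with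 $G\subseteq F_x$ for some $x\in P$. A presentation of a $KP$-algebra $T$ is a pair $(\Pi,p)$ of a system $\Pi=(F_x)_{x\in P}$ of subsets of a finite set $F$ with $F_x\cap F_y=\bigcup_{z\le x,\,z\le y}F_z$ for all $x,y\in P$, and a surjection $p\colon T^\Pi\to T$ of $KP$-algebras, i.e. surjective $K$-algebra homomorphisms $p_x\colon K[F_x]\to T_x$ compatible with the structure maps; $p_P\colon\lim_PT^\Pi\to\lim_PT$ is the induced map. It is a presentation of the sectioned $KP$-algebra $T$ if in addition $p_P\circ\iota(T^\Pi)_x=\iota(T)_x\circ p_x$ for every $x\in P$. *)

(* Defs.v *)
From HB Require Import structures.
From mathcomp Require Import all_boot all_order all_algebra.
From mathcomp Require Import boolp classical_sets.
From mathcomp Require Import mpoly.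

Set Implicit Arguments.
Unset Strict Implicit.
Unset Printing Implicit Defensive.

Import Order.TTheory GRing.Theory.
Local Open Scope classical_set_scope.
Local Open Scope ring_scope.

(* The library's [comAlgType K] only has nonzero algebras.  The zero algebra is
   needed here (the limit over the empty poset, quotients by the unit ideal), so
   a commutative [K]-algebra is a commutative ring, possibly zero, with a ring
   homomorphism from [K]. *)
Record comAlg (K : comPzRingType) := ComAlg {
  alg_ring :> comPzRingType;
  alg_map : {rmorphism K -> alg_ring}
}.

Definition alg_scale (K : comPzRingType) (A : comAlg K) (k : K) (a : A) : A :=
  alg_map A k * a.

Record algHom (K : comPzRingType) (A B : comAlg K) := AlgHom {
  alg_hom :> {rmorphism A -> B};
  alg_homE : forall k, alg_hom (alg_map A k) = alg_map B k
}.

Record algLin (K : comPzRingType) (A B : comAlg K) := AlgLin {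
  alg_lin :> {additive A -> B};
  alg_linZ : forall k a, alg_lin (alg_scale k a) = alg_scale k (alg_lin a)
}.

Definition algIso (K : comPzRingType) (A B : comAlg K) : Prop :=
  exists f : algHom A B, bijective f.

Definition alg_id (K : comPzRingType) (A : comAlg K) : algHom A A :=
  @AlgHom K A A idfun (fun=> erefl).

Section Comp.
Variables (K : comPzRingType) (A B C : comAlg K).

Fact alg_comp_subproof (g : algHom B C) (f : algHom A B) k :
  (g \o f) (alg_map A k) = alg_map C k.
Proof. by rewrite /= !alg_homE. Qed.

Definition alg_comp (g : algHom B C) (f : algHom A B) : algHom A C :=
  AlgHom (alg_comp_subproof g f).

Fact lin_of_hom_subproof (f : algHom A B) k a :
  f (alg_scale k a) = alg_scale k (f a).
Proof. by rewrite /alg_scale rmorphM alg_homE. Qed.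

Definition lin_of_hom (f : algHom A B) : algLin A B :=
  AlgLin (lin_of_hom_subproof f).

Fact lin_comp_subproof (g : algLin B C) (f : algLin A B) k a :
  (g \o f) (alg_scale k a) = alg_scale k ((g \o f) a).
Proof. by rewrite /= !alg_linZ. Qed.

Definition lin_comp (g : algLin B C) (f : algLin A B) : algLin A C :=
  AlgLin (lin_comp_subproof g f).
End Comp.

Record ideal (R : comPzRingType) := Ideal {
  ideal_set :> R -> Prop;
  ideal0 : ideal_set 0;
  idealD : forall a b, ideal_set a -> ideal_set b -> ideal_set (a + b);
  idealM : forall c a, ideal_set a -> ideal_set (c * a)
}.

Lemma idealP (R : comPzRingType) (I J : ideal R) :
  (forall a, I a <-> J a) -> I = J.
Proof.
case: I J => [I I0 ID IM] [J J0 JD JM] /= IJ.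
have {}IJ : I = J by apply/funext => a; apply/propext.
case: _ / IJ in J0 JD JM *.
by congr Ideal; apply: Prop_irrelevance.
Qed.

Section IdealOperations.
Variable R : comPzRingType.

Fact kernel_subproof0 (S : pzRingType) (f : {rmorphism R -> S}) :
  [set a | f a = 0] 0.
Proof. exact: rmorph0. Qed.
Fact kernel_subproofD (S : pzRingType) (f : {rmorphism R -> S}) a b :
  f a = 0 -> f b = 0 -> f (a + b) = 0.
Proof. by rewrite rmorphD => -> ->; rewrite addr0. Qed.
Fact kernel_subproofM (S : pzRingType) (f : {rmorphism R -> S}) c a :
  f a = 0 -> f (c * a) = 0.
Proof. by rewrite rmorphM => ->; rewrite mulr0. Qed.
Definition kernel (S : pzRingType) (f : {rmorphism R -> S}) : ideal R :=
  @Ideal R [set a | f a = 0]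
    (kernel_subproof0 f) (@kernel_subproofD S f) (@kernel_subproofM S f).

Definition span_set (S : set R) : set R :=
  [set a | exists s : seq (R * R),
     (forall u, u \in s -> S u.2) /\ a = \sum_(u <- s) u.1 * u.2].
Fact span_subproof0 S : span_set S 0.
Proof. by exists [::]; rewrite big_nil. Qed.
Fact span_subproofD S a b : span_set S a -> span_set S b -> span_set S (a + b).
Proof.
move=> [s [Ss ->]] [t [St ->]]; exists (s ++ t); rewrite big_cat; split=> // u.
by rewrite mem_cat => /orP[/Ss|/St].
Qed.
Fact span_subproofM S c a : span_set S a -> span_set S (c * a).
Proof.
move=> [s [Ss ->]]; exists [seq (c * u.1, u.2) | u <- s]; split=> [u|].
  by move=> /mapP[v /Ss Sv ->].
by rewrite big_map mulr_sumr; apply: eq_bigr => u _; rewrite mulrA.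
Qed.
Definition span_ideal (S : set R) : ideal R :=
  Ideal (@span_subproof0 S) (@span_subproofD S) (@span_subproofM S).

Definition add_ideal_set (I J : ideal R) : set R :=
  [set c | exists a b, [/\ I a, J b & c = a + b]].
Fact add_ideal_subproof0 I J : add_ideal_set I J 0.
Proof. by exists 0, 0; split; rewrite ?addr0 //; apply: ideal0. Qed.
Fact add_ideal_subproofD I J a b :
  add_ideal_set I J a -> add_ideal_set I J b -> add_ideal_set I J (a + b).
Proof.
move=> [a1 [a2 [Ia Ja ->]]] [b1 [b2 [Ib Jb ->]]]; exists (a1 + b1), (a2 + b2).
by split; [apply: idealD | apply: idealD | rewrite addrACA].
Qed.
Fact add_ideal_subproofM I J c a :
  add_ideal_set I J a -> add_ideal_set I J (c * a).
Proof.
move=> [a1 [a2 [Ia Ja ->]]]; exists (c * a1), (c * a2).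
by split; [apply: idealM | apply: idealM | rewrite mulrDr].
Qed.
Definition add_ideal (I J : ideal R) : ideal R :=
  Ideal (@add_ideal_subproof0 I J) (@add_ideal_subproofD I J)
    (@add_ideal_subproofM I J).

Section Families.
Variables (T : finType) (I : T -> ideal R).

Definition sum_ideal_set : set R :=
  [set a | exists g : T -> R, (forall i, I i (g i)) /\ a = \sum_i g i].
Fact sum_ideal_subproof0 : sum_ideal_set 0.
Proof.
by exists (fun=> 0); split=> [i|]; [apply: ideal0 | rewrite big1].
Qed.
Fact sum_ideal_subproofD a b :
  sum_ideal_set a -> sum_ideal_set b -> sum_ideal_set (a + b).
Proof.
move=> [g [Ig ->]] [h [Ih ->]]; exists (fun i => g i + h i).
by rewrite big_split; split=> // i; apply: idealD.
Qed.
Fact sum_ideal_subproofM c a : sum_ideal_set a -> sum_ideal_set (c * a).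
Proof.
move=> [g [Ig ->]]; exists (fun i => c * g i).
by rewrite mulr_sumr; split=> // i; apply: idealM.
Qed.
Definition sum_ideal : ideal R :=
  Ideal sum_ideal_subproof0 sum_ideal_subproofD sum_ideal_subproofM.

Definition cap_ideal_set : set R := [set a | forall i, I i a].
Fact cap_ideal_subproof0 : cap_ideal_set 0.
Proof. by move=> i; apply: ideal0. Qed.
Fact cap_ideal_subproofD a b :
  cap_ideal_set a -> cap_ideal_set b -> cap_ideal_set (a + b).
Proof. by move=> Ia Ib i; apply: idealD. Qed.
Fact cap_ideal_subproofM c a : cap_ideal_set a -> cap_ideal_set (c * a).
Proof. by move=> Ia i; apply: idealM. Qed.
Definition cap_ideal : ideal R :=
  Ideal cap_ideal_subproof0 cap_ideal_subproofD cap_ideal_subproofM.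
End Families.
End IdealOperations.

(* [Quotient.quot] is the library's quotient of an additive group; its ring
   structure is only provided for proper ideals. *)
Section Quotient.
Variables (R : comPzRingType) (I : ideal R).

Definition ideal_mem : {pred R} := fun a => `[< I a >].

Fact ideal_mem_zmod_closed : zmod_closed ideal_mem.
Proof.
split=> [|a b /asboolP Ia /asboolP Ib]; first exact/asboolP/ideal0.
by apply/asboolP/idealD => //; rewrite -mulN1r; apply: idealM.
Qed.
HB.instance Definition _ :=
  GRing.isZmodClosed.Build R ideal_mem ideal_mem_zmod_closed.

Definition quo_ring := Quotient.quot ideal_mem.
HB.instance Definition _ := GRing.Zmodule.on quo_ring.

Definition quo_pi (a : R) : quo_ring := \pi_quo_ring%qT a.
Definition quo_one : quo_ring := quo_pi 1.
Definition quo_mul (u v : quo_ring) : quo_ring := quo_pi (repr u * repr v).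

Lemma quo_piP a b : quo_pi a = quo_pi b <-> I (a - b).
Proof.
split=> [/eqP|Iab]; first by rewrite -Quotient.idealrBE => /asboolP.
by apply/eqP; rewrite -Quotient.idealrBE; apply/asboolP.
Qed.

Lemma quo_piK u : quo_pi (repr u) = u. Proof. exact: reprK. Qed.

Fact quo_pi_is_zmod_morphism : zmod_morphism quo_pi.
Proof. by move=> a b; rewrite /quo_pi !piE. Qed.
HB.instance Definition _ :=
  GRing.isZmodMorphism.Build R quo_ring quo_pi quo_pi_is_zmod_morphism.

Lemma quo_piM a b : quo_mul (quo_pi a) (quo_pi b) = quo_pi (a * b).
Proof.
apply/quo_piP; set a' := repr _; set b' := repr _.
have -> : a' * b' - a * b = b' * (a' - a) + a * (b' - b).
  by rewrite !mulrBr (mulrC b') addrA (mulrC b' a) subrK.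
by apply: idealD; apply: idealM; apply/quo_piP; rewrite quo_piK.
Qed.

Fact quo_mulA : associative quo_mul.
Proof.
move=> u v w; rewrite -(quo_piK u) -(quo_piK v) -(quo_piK w).
by rewrite !quo_piM mulrA.
Qed.
Fact quo_mulC : commutative quo_mul.
Proof. by move=> u v; rewrite /quo_mul mulrC. Qed.
Fact quo_mul1 : left_id quo_one quo_mul.
Proof. by move=> u; rewrite -(quo_piK u) quo_piM mul1r. Qed.
Fact quo_mulDl : left_distributive quo_mul +%R.
Proof.
move=> u v w; rewrite -(quo_piK u) -(quo_piK v) -(quo_piK w).
have piD : {morph quo_pi : a b / a + b} by exact: raddfD.
by rewrite !quo_piM -!piD quo_piM mulrDl.
Qed.
HB.instance Definition _ := GRing.Zmodule_isComPzRing.Build quo_ring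
  quo_mulA quo_mulC quo_mul1 quo_mulDl.

Fact quo_pi_is_monoid_morphism : monoid_morphism quo_pi.
Proof. by split=> // a b; rewrite -quo_piM. Qed.
HB.instance Definition _ :=
  GRing.isMonoidMorphism.Build R quo_ring quo_pi quo_pi_is_monoid_morphism.
End Quotient.

Definition quotient (K : comPzRingType) (A : comAlg K) (I : ideal A) : comAlg K :=
  @ComAlg K (quo_ring I) (quo_pi I \o alg_map A).

Record kpAlg (K : comPzRingType) (d : Order.disp_t) (P : finPOrderType d) :=
  KPAlg {
    kp_alg :> P -> comAlg K;
    kp_res : forall x y, (x <= y)%O -> algHom (kp_alg y) (kp_alg x);
    kp_res_id : forall x (xx : (x <= x)%O) a, kp_res xx a = a;
    kp_res_comp : forall x y z (xy : (x <= y)%O) (yz : (y <= z)%O)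
      (xz : (x <= z)%O) a, kp_res xy (kp_res yz a) = kp_res xz a
  }.

Section Limit.
Variables (K : comPzRingType) (d : Order.disp_t) (P : finPOrderType d).
Variable T : kpAlg K P.

Definition compatible (s : {dffun forall x : P, T x}) : Prop :=
  forall x y (xy : (x <= y)%O), kp_res T xy (s y) = s x.

Definition lim_ring := {s : {dffun forall x : P, T x} | `[< compatible s >]}.
HB.instance Definition _ := Choice.on lim_ring.

Definition lim_val (s : lim_ring) (x : P) : T x := val s x.

Lemma lim_compat (s : lim_ring) : compatible (val s).
Proof. exact/asboolP/(valP s). Qed.

Lemma limP (s t : lim_ring) : (forall x, lim_val s x = lim_val t x) -> s = t.
Proof. by move=> st; apply/val_inj/ffunP. Qed.

Section Family.
Variables (s : forall x, T x)
  (sP : forall x y (xy : (x <= y)%O), kp_res T xy (s y) = s x).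
Fact lim_of_subproof : `[< compatible [ffun x => s x] >].
Proof. by apply/asboolP => x y xy; rewrite !ffunE. Qed.
Definition lim_of : lim_ring := Sub [ffun x => s x] lim_of_subproof.
Lemma lim_ofE x : lim_val lim_of x = s x.
Proof. by rewrite /lim_val SubK ffunE. Qed.
End Family.

Fact lim_zero_subproof x y (xy : (x <= y)%O) : kp_res T xy 0 = 0.
Proof. exact: rmorph0. Qed.
Fact lim_one_subproof x y (xy : (x <= y)%O) : kp_res T xy 1 = 1.
Proof. exact: rmorph1. Qed.
Fact lim_opp_subproof (s : lim_ring) x y (xy : (x <= y)%O) :
  kp_res T xy (- lim_val s y) = - lim_val s x.
Proof. by rewrite rmorphN (lim_compat s). Qed.
Fact lim_add_subproof (s t : lim_ring) x y (xy : (x <= y)%O) :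
  kp_res T xy (lim_val s y + lim_val t y) = lim_val s x + lim_val t x.
Proof. by rewrite rmorphD (lim_compat s) (lim_compat t). Qed.
Fact lim_mul_subproof (s t : lim_ring) x y (xy : (x <= y)%O) :
  kp_res T xy (lim_val s y * lim_val t y) = lim_val s x * lim_val t x.
Proof. by rewrite rmorphM (lim_compat s) (lim_compat t). Qed.

Definition lim_zero := lim_of lim_zero_subproof.
Definition lim_one := lim_of lim_one_subproof.
Definition lim_opp s := lim_of (lim_opp_subproof s).
Definition lim_add s t := lim_of (lim_add_subproof s t).
Definition lim_mul s t := lim_of (lim_mul_subproof s t).

Fact lim_addA : associative lim_add.
Proof. by move=> s t u; apply/limP => x; rewrite !lim_ofE addrA. Qed.
Fact lim_addC : commutative lim_add.
Proof. by move=> s t; apply/limP => x; rewrite !lim_ofE addrC. Qed.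
Fact lim_add0 : left_id lim_zero lim_add.
Proof. by move=> s; apply/limP => x; rewrite !lim_ofE add0r. Qed.
Fact lim_addN : left_inverse lim_zero lim_opp lim_add.
Proof. by move=> s; apply/limP => x; rewrite !lim_ofE addNr. Qed.
HB.instance Definition _ :=
  GRing.isZmodule.Build lim_ring lim_addA lim_addC lim_add0 lim_addN.

Fact lim_mulA : associative lim_mul.
Proof. by move=> s t u; apply/limP => x; rewrite !lim_ofE mulrA. Qed.
Fact lim_mulC : commutative lim_mul.
Proof. by move=> s t; apply/limP => x; rewrite !lim_ofE mulrC. Qed.
Fact lim_mul1 : left_id lim_one lim_mul.
Proof. by move=> s; apply/limP => x; rewrite !lim_ofE mul1r. Qed.
Fact lim_mulDl : left_distributive lim_mul +%R.
Proof. by move=> s t u; apply/limP => x; rewrite !lim_ofE mulrDl. Qed.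
HB.instance Definition _ := GRing.Zmodule_isComPzRing.Build lim_ring
  lim_mulA lim_mulC lim_mul1 lim_mulDl.

Definition lim_proj_fun (x : P) (s : lim_ring) : T x := lim_val s x.
Fact lim_proj_is_zmod_morphism x : zmod_morphism (lim_proj_fun x).
Proof. by move=> s t; rewrite /lim_proj_fun !lim_ofE. Qed.
Fact lim_proj_is_monoid_morphism x : monoid_morphism (lim_proj_fun x).
Proof. by split=> [|s t]; rewrite /lim_proj_fun lim_ofE. Qed.
HB.instance Definition _ x := GRing.isZmodMorphism.Build _ _ (lim_proj_fun x)
  (lim_proj_is_zmod_morphism x).
HB.instance Definition _ x := GRing.isMonoidMorphism.Build _ _ (lim_proj_fun x)
  (lim_proj_is_monoid_morphism x).

Section Induced.
Variables (R : comPzRingType) (f : forall x, {rmorphism R -> T x}).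
Hypothesis fP : forall x y (xy : (x <= y)%O) a, kp_res T xy (f y a) = f x a.
Definition lim_induced_fun (a : R) : lim_ring :=
  lim_of (fun x y (xy : (x <= y)%O) => fP xy a).
Fact lim_induced_is_zmod_morphism : zmod_morphism lim_induced_fun.
Proof. by move=> a b; apply/limP => x; rewrite !lim_ofE rmorphB. Qed.
Fact lim_induced_is_monoid_morphism : monoid_morphism lim_induced_fun.
Proof.
by split=> [|a b]; apply/limP => x; rewrite !lim_ofE ?rmorph1 ?rmorphM.
Qed.
HB.instance Definition _ := GRing.isZmodMorphism.Build _ _ lim_induced_fun
  lim_induced_is_zmod_morphism.
HB.instance Definition _ := GRing.isMonoidMorphism.Build _ _ lim_induced_fun
  lim_induced_is_monoid_morphism.
Definition lim_induced_rmorphism : {rmorphism R -> lim_ring} := lim_induced_fun.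
End Induced.

Fact lim_alg_subproof x y (xy : (x <= y)%O) k :
  kp_res T xy (alg_map (T y) k) = alg_map (T x) k.
Proof. exact: alg_homE. Qed.
Definition lim : comAlg K :=
  @ComAlg K lim_ring (lim_induced_rmorphism lim_alg_subproof).

Fact lim_proj_subproof x k : lim_proj_fun x (alg_map lim k) = alg_map (T x) k.
Proof. exact: lim_ofE. Qed.
Definition lim_proj x : algHom lim (T x) :=
  @AlgHom K lim (T x) (lim_proj_fun x) (lim_proj_subproof x).

Section InducedHom.
Variables (A : comAlg K) (f : forall x, algHom A (T x)).
Hypothesis fP : forall x y (xy : (x <= y)%O) a, kp_res T xy (f y a) = f x a.
Fact lim_induced_subproof k :
  lim_induced_rmorphism (f := f) fP (alg_map A k) = alg_map lim k.
Proof. by apply/limP => x; rewrite !lim_ofE alg_homE. Qed.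
Definition lim_induced : algHom A lim :=
  @AlgHom K A lim (lim_induced_rmorphism fP) lim_induced_subproof.

Lemma lim_inducedE x a : lim_proj x (lim_induced a) = f x a.
Proof. exact: lim_ofE. Qed.
End InducedHom.
End Limit.

Record sectionedKPAlg (K : comPzRingType) (d : Order.disp_t)
    (P : finPOrderType d) := SectionedKPAlg {
  sectioned_alg :> kpAlg K P;
  kp_section : forall x, algLin (sectioned_alg x) (lim sectioned_alg);
  kp_sectionK : forall x a, lim_proj sectioned_alg x (kp_section x a) = a
}.

Record kpHom (K : comPzRingType) (d : Order.disp_t) (P : finPOrderType d)
    (S T : kpAlg K P) := KPHom {
  kp_hom :> forall x, algHom (S x) (T x);
  kp_homP : forall x y (xy : (x <= y)%O) a,
    kp_res T xy (kp_hom y a) = kp_hom x (kp_res S xy a)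
}.

Section LimitMap.
Variables (K : comPzRingType) (d : Order.disp_t) (P : finPOrderType d).
Variables (S T : kpAlg K P) (p : kpHom S T).

Fact lim_map_subproof x y (xy : (x <= y)%O) (s : lim S) :
  kp_res T xy (alg_comp (p y) (lim_proj S y) s) =
  alg_comp (p x) (lim_proj S x) s.
Proof. by rewrite /= kp_homP; congr (p x _); apply: lim_compat. Qed.
Definition lim_map : algHom (lim S) (lim T) := lim_induced lim_map_subproof.
End LimitMap.

(* The polynomial ring whose variables are the elements of [A]; the variable
   [a] is the one of index [enum_rank a]. *)
Definition polyAlg (K : fieldType) (A : finType) : comAlg K :=
  @ComAlg K {mpoly K[#|A|]} (@mpolyC #|A| K).

Definition var (K : fieldType) (A : finType) (a : A) : polyAlg K A :=
  'X_(enum_rank a) : {mpoly K[#|A|]}.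

Section Substitution.
Variables (K : fieldType) (A B : finType) (h : A -> polyAlg K B).

Definition subst_rmorphism : {rmorphism polyAlg K A -> polyAlg K B} :=
  comp_mpoly [tuple (h (enum_val i) : {mpoly K[#|B|]}) | i < #|A|].
Fact subst_subproof k :
  subst_rmorphism (alg_map (polyAlg K A) k) = alg_map (polyAlg K B) k.
Proof. exact: comp_mpolyC. Qed.
(* The algebra homomorphism sending the variable [a] to [h a]. *)
Definition subst : algHom (polyAlg K A) (polyAlg K B) := AlgHom subst_subproof.

Lemma subst_var a : subst (var K a) = h a.
Proof. by rewrite /= /var comp_mpolyXU -tnth_nth tnth_mktuple enum_rankK. Qed.
End Substitution.

Lemma subst_ext (K : fieldType) (A B : finType)
    (f g : algHom (polyAlg K A) (polyAlg K B)) :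
  (forall a, f (var K a) = g (var K a)) -> f =1 g.
Proof.
move=> fg p.
rewrite [p](mpolyE (p : {mpoly K[#|A|]})) !rmorph_sum.
apply: eq_bigr => m _; rewrite -mul_mpolyC !rmorphM /=.
congr (_ * _); first by rewrite (alg_homE f) (alg_homE g).
rewrite mpolyXE_id !rmorph_prod; apply: eq_bigr => i _; rewrite !rmorphXn.
by congr (_ ^+ _); have := fg (enum_val i); rewrite /var enum_valK.
Qed.

Record subsetSystem (d : Order.disp_t) (P : finPOrderType d) (F : finType) :=
  SubsetSystem {
    sys_set :> P -> {set F};
    sys_setI : forall x y, sys_set x :&: sys_set y =
      (\bigcup_(z | (z <= x)%O && (z <= y)%O) sys_set z)%SET
  }.

Section System.
Variables (K : fieldType) (d : Order.disp_t) (P : finPOrderType d).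
Variables (F : finType) (Pi : subsetSystem P F).

Definition sysVar (x : P) : finType := {a : F | a \in Pi x}.

Definition sys_incl (x : P) : algHom (polyAlg K (sysVar x)) (polyAlg K F) :=
  subst (fun a : sysVar x => var K (val a)).

Definition sys_retr (x : P) : algHom (polyAlg K F) (polyAlg K (sysVar x)) :=
  subst (fun a : F => if insub a is Some b then var K (b : sysVar x) else 0).

Lemma sys_set_sub x y : (x <= y)%O -> Pi x \subset Pi y.
Proof.
move=> xy; apply/fintype.subsetP => a ax; suff: a \in Pi x :&: Pi y.
  by rewrite inE => /andP[].
by rewrite sys_setI; apply/bigcupP; exists x; rewrite ?lexx.
Qed.

Lemma sys_incl_var x (a : sysVar x) : sys_incl x (var K a) = var K (val a).
Proof. exact: subst_var. Qed.

Lemma sys_retr_var x (a : F) : sys_retr x (var K a) =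
  if insub a is Some b then var K (b : sysVar x) else 0.
Proof. exact: subst_var. Qed.

Lemma sys_inclK x : cancel (sys_incl x) (sys_retr x).
Proof.
apply: (@subst_ext _ _ _ (alg_comp (sys_retr x) (sys_incl x)) (alg_id _)) => a.
by rewrite [LHS]/= sys_incl_var sys_retr_var valK.
Qed.

Lemma sys_retr_retr x y (xy : (x <= y)%O) f :
  sys_retr x (sys_incl y (sys_retr y f)) = sys_retr x f.
Proof.
apply: (@subst_ext _ _ _
  (alg_comp (sys_retr x) (alg_comp (sys_incl y) (sys_retr y)))) => a.
rewrite [LHS]/= (sys_retr_var y); case: insubP => [b _ <-|ay].
  by rewrite sys_incl_var.
rewrite !rmorph0 sys_retr_var insubN //.
by apply: contra ay; apply/fintype.subsetP/sys_set_sub.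
Qed.

Definition sys_res x y (xy : (x <= y)%O) :
    algHom (polyAlg K (sysVar y)) (polyAlg K (sysVar x)) :=
  alg_comp (sys_retr x) (sys_incl y).

Fact sys_res_id x (xx : (x <= x)%O) f : sys_res xx f = f.
Proof. exact: sys_inclK. Qed.

Fact sys_res_comp x y z (xy : (x <= y)%O) (yz : (y <= z)%O) (xz : (x <= z)%O)
  f : sys_res xy (sys_res yz f) = sys_res xz f.
Proof. exact: sys_retr_retr. Qed.

Definition sysAlg : kpAlg K P := KPAlg sys_res_id sys_res_comp.

Fact sys_pi_subproof x y (xy : (x <= y)%O) f :
  kp_res sysAlg xy (sys_retr y f) = sys_retr x f.
Proof. exact: sys_retr_retr. Qed.

Definition sys_pi : algHom (polyAlg K F) (lim sysAlg) :=
  @lim_induced _ _ _ sysAlg _ sys_retr sys_pi_subproof.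

Definition sys_section x : algLin (sysAlg x) (lim sysAlg) :=
  lin_comp (lin_of_hom sys_pi) (lin_of_hom (sys_incl x)).

Fact sys_sectionK x f : lim_proj sysAlg x (sys_section x f) = f.
Proof. by rewrite -[RHS]sys_inclK; apply: lim_inducedE. Qed.

Definition sectionedSysAlg : sectionedKPAlg K P :=
  SectionedKPAlg sys_sectionK.

Definition sys_complex : {set {set F}} :=
  [set G : {set F} | [exists x, G \subset Pi x]]%SET.
End System.

Definition stanley_reisner (K : fieldType) (F : finType) (D : {set {set F}}) :
    ideal (polyAlg K F) :=
  span_ideal [set f | exists2 G : {set F}, G \notin D &
    f = \prod_(a in G) var K a].

Definition is_presentation (K : fieldType) (d : Order.disp_t)
    (P : finPOrderType d) (F : finType) (Pi : subsetSystem P F)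
    (T : kpAlg K P) (p : kpHom (sysAlg K Pi) T) : Prop :=
  forall x (b : T x), exists f, p x f = b.

Definition is_sectioned_presentation (K : fieldType) (d : Order.disp_t)
    (P : finPOrderType d) (F : finType) (Pi : subsetSystem P F)
    (T : sectionedKPAlg K P) (p : kpHom (sysAlg K Pi) T) : Prop :=
  is_presentation p /\
  forall x f,
    lim_map p (kp_section (sectionedSysAlg K Pi) x f) = kp_section T x (p x f).

(* Main.v *)
From HB Require Import structures.
Require Import Defs.
From mathcomp Require Import all_boot all_order all_algebra.
From mathcomp Require Import boolp classical_sets.
From mathcomp Require Import mpoly.

(** Write [e_x] for the idempotent [sys_incl x \o sys_retr x] of [K[F]]: it keeps
    the monomials whose variables all lie in [F_x] and kills the others
    ([sys_incl_retrE]).  All the [e_x] are thus diagonal in the basis of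
    monomials, and [K[F]] is the direct sum of their joint eigenspaces [V_S],
    for [S] a set of elements of [P]: [V_S] is spanned by the monomials of type
    [S], where the type of a monomial is the set of the [x] such that [F_x]
    contains all its variables.  The projection of [K[F]] onto [V_S] is
    [type_part S].

    The intersection of the kernels of the [pi_x] is [V_set0], which is spanned
    by the monomials whose support is not a face, hence is the Stanley-Reisner
    ideal ([cap_kernel_retr]).

    Let [N] be the kernel of [p_P \o pi].  The compatibility of [p] with the
    sections forces [iota_x] to map [Ker p_x] into [N]
    ([kernel_comp_incl]).  Hence [N] is stable under every [e_x], so also under
    the projections onto the [V_S], which are products of factors [e_x] and
    [1 - e_x] ([incl_retr_closed_type_part]).  So an element of [N] is a sum of
    components that lie in [N]; the component in [V_S] is fixed by [e_x] for any
    [x] in [S], hence comes from [Ker p_x], and the one in [V_set0] is in the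
    intersection of the [Ker pi_x].  This computes [N] ([kernel_comp]).

    For the isomorphism it remains to see that [p_P \o pi] is surjective.  An
    element [t] of [lim T] is to be lifted to a family of polynomials that is
    compatible, because [pi] is onto the limit of [T^Pi].  For each [x] and [S],
    consider all the components in [V_S] of the polynomials that lift [t_x].
    By the stability of [N], this set is the same for [x <= y] as soon as
    [S] contains [x] ([lift_parts_eq]).  A choice of an element that depends
    only on the set is then the same for [x] and [y].  Summing over [S] the
    elements chosen for [x] and applying [pi_x] gives a compatible family
    ([lift_compatible]), which lifts [t] ([lift_lifts]). *)

Set Implicit Arguments.
Unset Strict Implicit.
Unset Printing Implicit Defensive.

Import Order.TTheory GRing.Theory.

Local Open Scope classical_set_scope.
Local Open Scope ring_scope.

(** * Ideals *)

Section IdealLemmas.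
Variable R : comPzRingType.
Implicit Types (I J : ideal R) (S : set R).

Lemma ideal_sum I (T : Type) (r : seq T) (Q : pred T) (f : T -> R) :
  (forall i, Q i -> I (f i)) -> I (\sum_(i <- r | Q i) f i).
Proof.
by move=> If; apply: big_ind => //; [apply: ideal0 | apply: idealD].
Qed.

Lemma idealB I a b : I a -> I b -> I (a - b).
Proof.
by move=> Ia Ib; rewrite -mulN1r; apply: idealD => //; apply: idealM.
Qed.

Lemma mem_span S a : S a -> span_ideal S a.
Proof.
move=> Sa; exists [:: (1, a)]; rewrite big_seq1 mul1r; split=> // u.
by rewrite inE => /eqP ->.
Qed.

Lemma span_sub S I : (forall a, S a -> I a) -> forall a, span_ideal S a -> I a.
Proof.
move=> SI a [s [Ss ->]]; rewrite big_seq; apply: ideal_sum => u /Ss /SI Iu.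
exact: idealM.
Qed.

Lemma mem_sum_ideal (T : finType) (I : T -> ideal R) x a :
  I x a -> sum_ideal I a.
Proof.
move=> Ia; exists (fun y => if y == x then a else 0); split=> [y|].
  by case: eqP => [-> //|_]; apply: ideal0.
by rewrite -big_mkcond big_pred1_eq.
Qed.

Lemma sum_ideal_sub (T : finType) (I : T -> ideal R) J :
  (forall x a, I x a -> J a) -> forall a, sum_ideal I a -> J a.
Proof.
by move=> IJ a [g [Ig ->]]; apply: ideal_sum => x _; apply: IJ (Ig x).
Qed.

Lemma mem_add_ideall I J a : I a -> add_ideal I J a.
Proof. by move=> Ia; exists a, 0; split; rewrite ?addr0 //; apply: ideal0. Qed.

Lemma mem_add_idealr I J a : J a -> add_ideal I J a.
Proof. by move=> Ja; exists 0, a; split; rewrite ?add0r //; apply: ideal0. Qed.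

End IdealLemmas.

(** * The first isomorphism theorem *)

Section FirstIsomorphism.
Variables (K : comPzRingType) (A B : comAlg K) (q : algHom A B).
Hypothesis q_surj : forall b, exists a, q a = b.

Definition some_preimage (b : B) : A := projT1 (cid (q_surj b)).

Lemma some_preimageK b : q (some_preimage b) = b.
Proof. exact: projT2 (cid (q_surj b)). Qed.

Definition to_quo (b : B) : quotient (kernel q) :=
  quo_pi (kernel q) (some_preimage b).

Lemma to_quoE a : to_quo (q a) = quo_pi (kernel q) a.
Proof. by apply/quo_piP; rewrite /= rmorphB some_preimageK subrr. Qed.

Lemma to_quo_is_zmod_morphism : zmod_morphism to_quo.
Proof.
move=> b c; rewrite -(some_preimageK b) -(some_preimageK c) -rmorphB !to_quoE.
exact: raddfB.
Qed.

Lemma to_quo_is_monoid_morphism : monoid_morphism to_quo.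
Proof.
split=> [|b c]; first by rewrite -(rmorph1 q) to_quoE.
rewrite -(some_preimageK b) -(some_preimageK c) -rmorphM !to_quoE.
exact: rmorphM.
Qed.

HB.instance Definition _ := GRing.isZmodMorphism.Build B
  (quotient (kernel q)) to_quo to_quo_is_zmod_morphism.
HB.instance Definition _ := GRing.isMonoidMorphism.Build B
  (quotient (kernel q)) to_quo to_quo_is_monoid_morphism.

Lemma to_quo_alg k : to_quo (alg_map B k) = alg_map (quotient (kernel q)) k.
Proof. by rewrite -(alg_homE q) to_quoE. Qed.

Lemma first_isomorphism : algIso B (quotient (kernel q)).
Proof.
exists (AlgHom (alg_hom := to_quo) to_quo_alg).
exists (fun u => q (repr u)) => [b|u] /=.
  have /quo_piP :
      quo_pi (kernel q) (repr (to_quo b)) = quo_pi _ (some_preimage b).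
    exact: quo_piK.
  by rewrite /= rmorphB some_preimageK => /subr0_eq.
by rewrite to_quoE quo_piK.
Qed.

End FirstIsomorphism.

(** * Selecting the monomials of a polynomial *)

Section MonomialRestriction.
Variables (n : nat) (R : nzRingType).
Implicit Types (Q : pred 'X_{1..n}) (f g : {mpoly R[n]}).

Definition mrestrict Q f : {mpoly R[n]} :=
  \sum_(m <- msupp f | Q m) (f@_m)%:MP * 'X_[m].

Lemma mcoeff_mrestrict Q f m : (mrestrict Q f)@_m = f@_m *+ Q m.
Proof.
rewrite /mrestrict raddf_sum /=.
under eq_bigr do rewrite mcoeffCM mcoeffX.
have [mf|mf] := boolP (m \in msupp f); last first.
  rewrite (memN_msupp_eq0 mf) mul0rn big_seq_cond big1 // => m' /andP[m'f _].
  by case: eqP => [mm'|]; rewrite ?mulr0 //; rewrite mm' (negPf mf) in m'f.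
rewrite big_mkcond (bigD1_seq m) //= eqxx mulr1 big1 ?addr0 => [|m' /negPf ->].
  by case: (Q m).
by rewrite mulr0 if_same.
Qed.

Lemma mrestrictB Q f g : mrestrict Q (f - g) = mrestrict Q f - mrestrict Q g.
Proof. by apply/mpolyP => m; rewrite !(mcoeffB, mcoeff_mrestrict) mulrnBl. Qed.

Lemma mrestrict_comp Q Q' f :
  mrestrict Q (mrestrict Q' f) = mrestrict (predI Q Q') f.
Proof.
apply/mpolyP => m; rewrite !mcoeff_mrestrict /=.
by case: (Q m); case: (Q' m); rewrite //= !mulr0n.
Qed.

Lemma eq_mrestrict Q Q' f : Q =1 Q' -> mrestrict Q f = mrestrict Q' f.
Proof. by move=> QQ'; apply/mpolyP => m; rewrite !mcoeff_mrestrict QQ'. Qed.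

Lemma mrestrictT f : mrestrict predT f = f.
Proof. by apply/mpolyP => m; rewrite mcoeff_mrestrict. Qed.

Lemma mrestrict_pred0 f : mrestrict pred0 f = 0.
Proof. by apply/mpolyP => m; rewrite mcoeff_mrestrict mcoeff0. Qed.

Lemma mrestrictC Q f : mrestrict (predC Q) f = f - mrestrict Q f.
Proof.
apply/mpolyP => m; rewrite mcoeffB !mcoeff_mrestrict /=.
by case: (Q m); rewrite ?subrr ?subr0.
Qed.

Lemma sum_mrestrict (T : finType) (c : 'X_{1..n} -> T) f :
  \sum_t mrestrict (fun m => c m == t) f = f.
Proof.
apply/mpolyP => m; rewrite raddf_sum /= (bigD1 (c m)) //= mcoeff_mrestrict eqxx.
rewrite big1 ?addr0 // => t /negPf tc.
by rewrite mcoeff_mrestrict eq_sym tc.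
Qed.

End MonomialRestriction.

(** * Decomposition of a polynomial ring by monomial types *)

Section MonomialTypes.
Variables (K : fieldType) (d : Order.disp_t) (P : finPOrderType d).
Variables (F : finType) (Pi : subsetSystem P F).
Local Notation n := #|F|.
Implicit Types (x y : P) (S : {set P}).

Definition mvars (m : 'X_{1..n}) : {set F} :=
  [set a | m (enum_rank a) != 0%N]%SET.

Definition mtype (m : 'X_{1..n}) : {set P} :=
  [set x | mvars m \subset Pi x]%SET.

Definition type_part (S : {set P}) (f : polyAlg K F) : polyAlg K F :=
  mrestrict (fun m => mtype m == S) f.

(** The cast makes sums and products of monomials use the ring structure of
    [polyAlg K F]; it is convertible to that of multivariate polynomials, but
    rewriting does not identify the two. *)
Definition monomial (m : 'X_{1..n}) : polyAlg K F := 'X_[m] : {mpoly K[n]}.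

Lemma monomialE m : monomial m = \prod_(a : F) var K a ^+ m (enum_rank a).
Proof.
rewrite /monomial mpolyXE_id; exact: (reindex _ (onW_bij _ (@enum_rank_bij F))).
Qed.

Lemma polyAlgE (f : polyAlg K F) :
  f = \sum_(m <- msupp (f : {mpoly K[n]}))
        alg_map (polyAlg K F) (f : {mpoly K[n]})@_m * monomial m.
Proof. by rewrite -[LHS](mrestrictT (f : {mpoly K[n]})). Qed.

Lemma sys_incl_retr_var x (a : F) :
  sys_incl K Pi x (sys_retr K Pi x (var K a)) = var K a *+ (a \in Pi x).
Proof.
rewrite sys_retr_var; case: insubP => [b -> <-|/negPf ->].
  by rewrite sys_incl_var.
by rewrite rmorph0.
Qed.

Lemma sys_incl_retrX x (m : 'X_{1..n}) :
  sys_incl K Pi x (sys_retr K Pi x (monomial m)) =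
  monomial m *+ (x \in mtype m).
Proof.
rewrite monomialE !rmorph_prod inE.
under eq_bigr do rewrite !rmorphXn sys_incl_retr_var.
have [/fintype.subsetP mx|] := boolP (mvars m \subset Pi x).
  apply: eq_bigr => a _; case: (eqVneq (m (enum_rank a)) 0%N) => [->|ma].
    by rewrite !expr0.
  by rewrite mx // inE.
case/subsetPn => a; rewrite inE => ma ax.
by rewrite (bigD1 a) //= (negPf ax) expr0n (negPf ma) mul0r.
Qed.

(** The algebra endomorphism [e_x] is diagonal in the basis of monomials, because
    it fixes or kills each variable. *)
Lemma sys_incl_retrE x f :
  sys_incl K Pi x (sys_retr K Pi x f) =
  mrestrict (fun m => x \in mtype m) (f : {mpoly K[n]}).
Proof.
(* The composite is named and passed to the morphism lemmas: a substitution is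
   itself a sum over monomials, which [rmorph_sum] would unfold. *)
pose e := alg_comp (sys_incl K Pi x) (sys_retr K Pi x).
have -> : sys_incl K Pi x (sys_retr K Pi x f) = e f by [].
rewrite [in LHS](polyAlgE f) (rmorph_sum e).
rewrite /mrestrict [RHS](big_mkcond (R := polyAlg K F)).
apply: eq_bigr => m _; rewrite (rmorphM e) (alg_homE e).
by rewrite [e _]sys_incl_retrX; case: ifP => _; rewrite ?mulr0.
Qed.

Lemma sum_type_part f : \sum_S type_part S f = f.
Proof. exact: sum_mrestrict. Qed.

Lemma type_partB S f g : type_part S (f - g) = type_part S f - type_part S g.
Proof. exact: mrestrictB. Qed.

Lemma type_part_id S f : type_part S (type_part S f) = type_part S f.
Proof.
by rewrite [LHS]mrestrict_comp; apply: eq_mrestrict => m /=; rewrite andbb.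
Qed.

Lemma sys_incl_retr_type_part x S f :
  sys_incl K Pi x (sys_retr K Pi x (type_part S f)) =
  type_part S f *+ (x \in S).
Proof.
rewrite sys_incl_retrE [LHS]mrestrict_comp; case: (boolP (x \in S)) => xS.
  by apply: eq_mrestrict => m /=; case: eqP => [->|]; rewrite ?xS ?andbF.
rewrite mulr0n -[RHS](mrestrict_pred0 (f : {mpoly K[n]})).
by apply: eq_mrestrict => m /=; case: eqP => [->|]; rewrite ?(negPf xS) ?andbF.
Qed.

Lemma type_part_incl_retr x S f : x \in S ->
  type_part S (sys_incl K Pi x (sys_retr K Pi x f)) = type_part S f.
Proof.
move=> xS; rewrite sys_incl_retrE [LHS]mrestrict_comp.
by apply: eq_mrestrict => m /=; case: eqP => [->|].
Qed.

Lemma sys_incl_inj x : injective (sys_incl K Pi x).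
Proof. exact: can_inj (sys_inclK (Pi := Pi) (x := x)). Qed.

Lemma sys_retr_type_part0 x S f : x \notin S ->
  sys_retr K Pi x (type_part S f) = 0.
Proof.
move=> xS; apply: sys_incl_inj.
by rewrite sys_incl_retr_type_part (negPf xS) rmorph0.
Qed.

(** The projection onto the monomials of type [S] is the product of the [e_x] for
    [x] in [S] and of the [1 - e_x] for [x] outside [S]; each factor preserves
    [N], and induction on a list of elements of [P] multiplies them up. *)
Lemma incl_retr_closed_type_part (N : ideal (polyAlg K F)) :
  (forall x f, N f -> N (sys_incl K Pi x (sys_retr K Pi x f))) ->
  forall S f, N f -> N (type_part S f).
Proof.
move=> Ne S f Nf.
pose Q (r : seq P) m := all (fun x => (x \in mtype m) == (x \in S)) r.
suff NQ (r : seq P) : N (mrestrict (Q r) (f : {mpoly K[n]})).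
  rewrite [type_part _ _](_ : _ = mrestrict (Q (enum P)) (f : {mpoly K[n]})) //.
  apply: eq_mrestrict => m; apply/eqP/allP => [-> //|mS].
  by apply/setP => x; apply/eqP/mS; rewrite mem_enum.
elim: r => [|x r IHr]; first by rewrite mrestrictT.
have := Ne x _ IHr; rewrite sys_incl_retrE => NIr.
case: (boolP (x \in S)) => xS.
  rewrite mrestrict_comp in NIr.
  rewrite (eq_mrestrict (Q' := predI (fun m => x \in mtype m) (Q r))) // => m.
  by rewrite /= xS eqb_id.
rewrite (eq_mrestrict (Q' := predI (predC (fun m => x \in mtype m)) (Q r))).
  by rewrite -mrestrict_comp mrestrictC; apply: idealB.
by move=> m; rewrite /= (negPf xS) eqbF_neg.
Qed.

(** A monomial is a multiple of the product of the variables that occur in it,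
    and this product is a generator of the ideal when its support is not a
    face. *)
Lemma monomial_in_stanley_reisner (m : 'X_{1..n}) :
  mtype m = finset.set0 ->
  stanley_reisner K (sys_complex Pi) (monomial m).
Proof.
move=> m0; rewrite monomialE.
have -> : \prod_a var K a ^+ m (enum_rank a) =
    \prod_a var K a ^+ (m (enum_rank a)).-1 * \prod_(a in mvars m) var K a.
  rewrite [X in _ * X]big_mkcond -big_split; apply: eq_bigr => a _ /=.
  by rewrite inE; case: (m _) => [|k]; rewrite ?mulr1 // exprSr.
apply/idealM/mem_span; exists (mvars m) => //.
rewrite inE; apply/existsP => -[x mx].
by have := finset.in_set0 x; rewrite -m0 inE mx.
Qed.

(** The operator [e_x] does not mix monomials, so it kills a polynomial only if it
    kills each of its monomials: those of a polynomial killed by all the [e_x]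
    have empty type. *)
Lemma cap_kernel_retr :
  cap_ideal (fun x => kernel (sys_retr K Pi x)) =
  stanley_reisner K (sys_complex Pi).
Proof.
apply: idealP => f; split=> [f0|].
  rewrite (polyAlgE f) big_seq; apply: ideal_sum => m mf.
  apply/idealM/monomial_in_stanley_reisner; apply/setP => x.
  rewrite inE finset.in_set0.
  apply: contraTF mf => mx; rewrite mcoeff_msupp negbK.
  have := sys_incl_retrE x f; rewrite (f0 x) rmorph0.
  by move/(congr1 (mcoeff m)); rewrite mcoeff_mrestrict inE mx mcoeff0 => ->.
apply: span_sub => {f} _ [G GD ->] x /=.
rewrite rmorph_prod; move: GD; rewrite inE negb_exists => /forallP/(_ x).
case/subsetPn => a aG ax; rewrite (bigD1 a) //= sys_retr_var insubN //.
by rewrite mul0r.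
Qed.

End MonomialTypes.

(** * Presentations of sectioned algebras *)

Section Presentation.
Variables (K : fieldType) (d : Order.disp_t) (P : finPOrderType d).
Variables (F : finType) (Pi : subsetSystem P F) (T : sectionedKPAlg K P).
Variable p : kpHom (sysAlg K Pi) T.
Hypothesis p_pres : is_sectioned_presentation p.

Local Notation q := (alg_comp (lim_map p) (sys_pi K Pi)).
Local Notation incl := (sys_incl K Pi).
Local Notation retr := (sys_retr K Pi).
Implicit Types (x y : P) (S : {set P}).

Lemma lim_val_sys_pi x f : lim_val (sys_pi K Pi f) x = retr x f.
Proof. exact: lim_ofE. Qed.

Lemma lim_val_comp x f : lim_val (q f) x = p x (retr x f).
Proof.
have -> : lim_val (q f) x = p x (lim_val (sys_pi K Pi f) x) by exact: lim_ofE.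
by rewrite lim_val_sys_pi.
Qed.

Lemma lim_val0 (U : kpAlg K P) x : lim_val (0 : lim U) x = 0.
Proof. exact: lim_ofE. Qed.

Lemma kernel_sys_pi :
  kernel (sys_pi K Pi) = cap_ideal (fun x => kernel (retr x)).
Proof.
apply: idealP => f; split=> [f0 x|f0].
  by rewrite /= -lim_val_sys_pi [sys_pi _ _ _]f0 lim_val0.
by apply: limP => x; rewrite lim_val_sys_pi lim_val0; apply: f0.
Qed.

Lemma kernel_compP f : kernel q f <-> forall x, p x (retr x f) = 0.
Proof.
split=> [f0 x|f0]; first by rewrite -lim_val_comp [q f]f0 lim_val0.
by apply: limP => x; rewrite lim_val_comp f0 lim_val0.
Qed.

(** This is where the sections enter: [p_P \o pi \o iota_x] is the section of
    [T] at [x] composed with [p_x]. *)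
Lemma kernel_comp_incl x h : p x h = 0 -> kernel q (incl x h).
Proof.
by move=> h0; have := p_pres.2 x h; rewrite h0 raddf0.
Qed.

(** For a type containing [x], vanishing at [x] alone controls the component of
    [f] at every element of [P]: that component is also the one of [e_x f], which
    is in the kernel of [p_P \o pi]. *)
Lemma kernel_comp_type_part x S f : x \in S -> p x (retr x f) = 0 ->
  kernel q (type_part Pi S f).
Proof.
move=> xS /kernel_comp_incl Nf; rewrite -(type_part_incl_retr Pi f xS).
apply: incl_retr_closed_type_part Nf => y g /kernel_compP Ng.
exact: kernel_comp_incl.
Qed.

(** The component of type [S] of an element of the kernel is again in the kernel;
    if [S] contains some [x], it is the image under [iota_x] of an element of
    [Ker p_x], and otherwise all the [pi_x] kill it. *)
Lemma kernel_comp :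
  kernel q = add_ideal
    (sum_ideal (fun x => span_ideal [set incl x f | f in kernel (p x)]))
    (cap_ideal (fun x => kernel (retr x))).
Proof.
apply: idealP => f; split=> [Nf|[g [h [Ng h0 ->]]]].
  rewrite -(sum_type_part Pi f); apply: ideal_sum => S _.
  have [->|[x xS]] := set_0Vmem S.
    apply: mem_add_idealr => x; apply: sys_retr_type_part0.
    by rewrite finset.in_set0.
  apply/mem_add_ideall/(@mem_sum_ideal _ _ _ x)/mem_span.
  exists (retr x (type_part Pi S f)); last by rewrite sys_incl_retr_type_part xS.
  have /kernel_compP/(_ x) fx : kernel q f by [].
  by have /kernel_compP/(_ x) := kernel_comp_type_part xS fx.
apply: idealD.
  move: g Ng; apply: sum_ideal_sub => x; apply: span_sub => _ [g gx <-].
  exact: kernel_comp_incl.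
by apply/kernel_compP => x; rewrite (h0 x) rmorph0.
Qed.

Section Surjectivity.
Hypothesis pi_surj : forall s, exists f, sys_pi K Pi f = s.
Variable t : lim T.

Definition lift_parts x S : set (polyAlg K F) :=
  [set type_part Pi S g | g in [set g | p x (retr x g) = lim_val t x]].

Lemma lift_exists x : exists g, p x (retr x g) = lim_val t x.
Proof.
have [h hx] := p_pres.1 x (lim_val t x).
by exists (incl x h); rewrite sys_inclK.
Qed.

Lemma lift_parts_kernel x S g h : x \in S ->
  p x (retr x g) = lim_val t x -> p x (retr x h) = lim_val t x ->
  kernel q (type_part Pi S g - type_part Pi S h).
Proof.
move=> xS gx hx; rewrite -type_partB; apply: kernel_comp_type_part xS _.
by rewrite !rmorphB gx hx subrr.
Qed.

(** The components at [y] are components at [x], as a lift of [t_y] is a lift of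
    [t_x].  Conversely, given lifts [g] of [t_x] and [h] of [t_y], the component of
    [h - g] is in the kernel of [p_P \o pi], so subtracting it from [h] gives
    another lift of [t_y], with the same component as [g]. *)
Lemma lift_parts_eq x y S : (x <= y)%O -> x \in S ->
  lift_parts x S = lift_parts y S.
Proof.
move=> xy xS.
have lift_le g : p y (retr y g) = lim_val t y -> p x (retr x g) = lim_val t x.
  have <- : kp_res T xy (lim_val t y) = lim_val t x by exact: lim_compat.
  by move=> <-; rewrite kp_homP /= sys_retr_retr.
apply/seteqP; split=> _ [g gx <-]; last by exists g => //; apply: lift_le.
have [h hy] := lift_exists y.
have /kernel_compP hgy := lift_parts_kernel xS (lift_le _ hy) gx.
exists (h - (type_part Pi S h - type_part Pi S g)).
  by rewrite /= 2!rmorphB hgy hy subr0.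
by rewrite !type_partB !type_part_id opprB addrC subrK.
Qed.

(** It matters that [xget] depends only on the set: equal sets of components at
    different elements of [P] give the same polynomial. *)
Definition lift_part x S : polyAlg K F := xget 0 (lift_parts x S).

Lemma lift_partP x S : lift_parts x S (lift_part x S).
Proof.
by have [g gx] := lift_exists x; apply: xgetI; exists g.
Qed.

Lemma retr_lift_part0 x y S : x \notin S -> retr x (lift_part y S) = 0.
Proof.
by move=> xS; have [g _ <-] := lift_partP y S; apply: sys_retr_type_part0.
Qed.

(** The sum runs over all types; [pi_x] kills the terms of type not containing
    [x] ([retr_lift_part0]). *)
Definition lift x : sysAlg K Pi x := retr x (\sum_S lift_part x S).

Lemma lift_compatible x y (xy : (x <= y)%O) :
  kp_res (sysAlg K Pi) xy (lift y) = lift x.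
Proof.
rewrite /= /lift sys_retr_retr // !(rmorph_sum (retr x)); apply: eq_bigr => S _.
have [xS|xS] := boolP (x \in S); last by rewrite !retr_lift_part0.
by rewrite /lift_part (lift_parts_eq xy xS).
Qed.

(** The chosen components come from different lifts of [t_x], but for a type
    containing [x] the components of two lifts agree modulo the kernel of
    [p_P \o pi], so they may all be replaced by those of one lift [g]. *)
Lemma lift_lifts x : p x (lift x) = lim_val t x.
Proof.
have [g gx] := lift_exists x; rewrite -gx -[in RHS](sum_type_part Pi g) /lift.
rewrite !(rmorph_sum (retr x)) !(rmorph_sum (p x)); apply: eq_bigr => S _.
have [xS|xS] := boolP (x \in S); last first.
  by rewrite retr_lift_part0 // sys_retr_type_part0.
have [h hx <-] := lift_partP x S.
have /kernel_compP/(_ x) := lift_parts_kernel xS hx gx.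
by rewrite !rmorphB => /subr0_eq.
Qed.

Lemma comp_surj_at : exists f, q f = t.
Proof.
have [f fE] := pi_surj (lim_of lift_compatible); exists f.
apply: limP => x; rewrite [q f]/= fE lim_ofE /= /lim_proj_fun lim_ofE.
exact: lift_lifts.
Qed.

End Surjectivity.

Lemma kernel_generators x :
  [set f | alg_comp (p x) (retr x) f = 0] `&` range (incl x) =
  [set incl x f | f in kernel (p x)].
Proof.
apply/seteqP; split=> [g [/= g0 [f _ fg]]|_ [f /= f0 <-]].
  by exists f => //; rewrite -fg sys_inclK in g0.
by split=> /=; rewrite ?sys_inclK //; exists f.
Qed.

End Presentation.

Theorem theorem6p6 (K : fieldType) (d : Order.disp_t) (P : finPOrderType d)
    (F : finType) (Pi : subsetSystem P F) (T : sectionedKPAlg K P)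
    (p : kpHom (sysAlg K Pi) T)
    (p_pres : is_sectioned_presentation p)
    (pi_surj : forall s, exists f, sys_pi K Pi f = s) :
  [/\ kernel (sys_pi K Pi) = cap_ideal (fun x => kernel (sys_retr K Pi x))
        /\ cap_ideal (fun x => kernel (sys_retr K Pi x)) =
            stanley_reisner K (sys_complex Pi),
      kernel (alg_comp (lim_map p) (sys_pi K Pi)) =
        add_ideal
          (sum_ideal (fun x =>
             span_ideal [set sys_incl K Pi x f | f in kernel (p x)]))
          (cap_ideal (fun x => kernel (sys_retr K Pi x)))
    & let I x := span_ideal
        ([set f | alg_comp (p x) (sys_retr K Pi x) f = 0] `&`
         range (sys_incl K Pi x)) in
      algIso (lim T)
        (quotient
          (add_ideal (sum_ideal I) (stanley_reisner K (sys_complex Pi))))].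
Proof.
split; [split | |] => [||| I].
- exact: kernel_sys_pi.
- exact: cap_kernel_retr.
- exact: kernel_comp.
have -> : I = fun x => span_ideal [set sys_incl K Pi x f | f in kernel (p x)].
  by apply/funext => x; rewrite /I kernel_generators.
rewrite -cap_kernel_retr -kernel_comp //.
exact/first_isomorphism/comp_surj_at.
Qed.
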